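(* Let $H$ be a monoid such that $H_{\mathrm{red}}$ is finitely generated, and let $r=\inf\overline R(H)$. Then $$\{q\in\mathbb Q\mid r\le q\le\rho(H)\}\subset\{\rho(L)\mid L\in\mathcal L(H)\},$$ and $r$ is the only possible limit point of the set $\{\rho(L)\mid L\in\mathcal L(H)\text{ and }1\le\rho(L)<r\}$. Moreover, $H$ is fully elastic if and only if $r=1$.
   Context: A monoid is a commutative cancellative semigroup with identity, written multiplicatively. $H^{\times}$ is the unit group of $H$ and $H_{\mathrm{red}}=H/H^{\times}=\{aH^{\times}\mid a\in H\}$ is the associated reduced monoid. An atom is a non-unit $u$ such that $u=ab$ with $a,b\in H$ implies $a\in H^\times$ or $b\in H^\times$. For a non-unit $a$, $\mathsf L(a)\subset\mathbb N$ is the set of all $k$ such that $a=u_1\cdots u_k$ with atoms $u_i$; for a unit $a$, $\mathsf L(a)=\{0\}$. $\mathcal L(H)=\{\mathsf L(a)\mid a\in H\}$. If $H_{\mathrm{red}}$ is finitely generated, every non-unit is a product of atoms and all $\mathsf L(a)$ are finite. For a finite set $L\subset \mathbb N$, $\rho(L)=\max L/\min L$, and $\rho(\{0\})=1$; $\rho(a)=\rho(\mathsf L(a))$; $\rho(H)=\sup\{\rho(L)\mid L\in\mathcal L(H)\}$. $H$ is fully elastic if for every $q\in\mathbb Q$ with $1<q<\rho(H)$ there is $L\in\mathcal L(H)$ with $\rho(L)=q$. For $a\in H\setminus H^\times$, the asymptotic elasticity is $\overline\rho(a)=\lim_{n\to\infty}\rho(a^n)$ (the limit exists), and $\overline R(H)=\{\overline\rho(a)\mid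 a\in H\setminus H^{\times}\}$ is the set of asymptotic elasticities. *)

(* Defs.v *)
From HB Require Import structures.
From mathcomp Require Import all_boot all_order all_algebra generic_quotient.
From mathcomp Require Import all_classical all_reals all_analysis.

Set Implicit Arguments.
Unset Strict Implicit.
Unset Printing Implicit Defensive.
Import Order.TTheory GRing.Theory Num.Theory.
Import numFieldNormedType.Exports.

Local Open Scope classical_set_scope.
Local Open Scope quotient_scope.
Local Open Scope group_scope.

HB.mixin Record Monoid_isCancelCom H of Monoid H := {
  ccmulC : commutative (fun a b : H => a * b);
  ccmulI : right_injective (fun a b : H => a * b)
}.

#[short(type="cancelComMonoidType")]
HB.structure Definition CancelComMonoid :=
  {H of Monoid_isCancelCom H & Monoid H}.

Definition finitely_generated (M : monoidType) : Prop :=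
  exists E : seq M, forall x : M,
    exists2 w : seq M, {subset w <= E} & x = \prod_(y <- w) y.

Section Units.
Variable H : monoidType.
Implicit Types a b u : H.

Definition monoid_unit a : Prop := exists b, a * b = 1 /\ b * a = 1.

Definition is_atom u : Prop :=
  ~ monoid_unit u /\
  forall a b, u = a * b -> monoid_unit a \/ monoid_unit b.

Definition set_of_lengths a : set nat :=
  [set k | (monoid_unit a /\ k = 0%N) \/
           (~ monoid_unit a /\
            exists s : seq H, [/\ size s = k,
              forall u, u \in s -> is_atom u & a = \prod_(u <- s) u])].

Definition system_of_lengths : set (set nat) := range set_of_lengths.

End Units.
Arguments system_of_lengths : clear implicits.

Section Reduced.
Variable H : cancelComMonoidType.
Implicit Types a b : H.

Definition unit_coset a : set H := [set a * u | u in @monoid_unit H].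

Definition associated : rel H := fun a b => `[< unit_coset a = unit_coset b >].

Lemma associated_refl : reflexive associated.
Proof. by move=> a; apply/asboolP. Qed.

Lemma associated_sym : symmetric associated.
Proof. by move=> a b; apply/asboolP/asboolP. Qed.

Lemma associated_trans : transitive associated.
Proof. by move=> b a c /asboolP ab /asboolP bc; apply/asboolP; rewrite ab. Qed.

Canonical associated_equiv :=
  EquivRel associated associated_refl associated_sym associated_trans.

Definition reduced : Type := {eq_quot associated}.
HB.instance Definition _ := Choice.on reduced.
HB.instance Definition _ := EqQuotient.on reduced.

Lemma pi_reducedP a b :
  \pi_reduced a = \pi_reduced b <-> unit_coset a = unit_coset b.
Proof. by split=> [/eqmodP/asboolP|ab]; last apply/eqmodP/asboolP. Qed.

Lemma unit_cosetM a a' b b' : unit_coset a = unit_coset a' ->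
  unit_coset b = unit_coset b' -> unit_coset (a * b) = unit_coset (a' * b').
Proof.
have h (c d e : H) : unit_coset c = unit_coset d ->
    unit_coset (e * c) = unit_coset (e * d).
  move=> cd.
  have E x : unit_coset (e * x) = [set e * y | y in unit_coset x].
    apply/seteqP; split=> y /=.
      by move=> [u uu <-]; exists (x * u); [exists u|rewrite mulgA].
    by move=> [_ [u uu <-] <-]; exists u; rewrite // mulgA.
  by rewrite !E cd.
by move=> aa' bb'; rewrite (h _ _ _ bb') ccmulC (h _ _ _ aa') ccmulC.
Qed.

Definition reduced_mul := lift_op2 reduced (fun a b => a * b).

Lemma pi_reduced_mul : {morph \pi_reduced : a b / a * b >-> reduced_mul a b}.
Proof.
unlock reduced_mul => a b /=.
by apply/pi_reducedP; apply: unit_cosetM; apply/pi_reducedP; symmetry;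
  exact: reprK.
Qed.
Canonical pi_reduced_mul_morph := PiMorph2 pi_reduced_mul.

Lemma reduced_mulA : associative reduced_mul.
Proof. by elim/quotW=> a; elim/quotW=> b; elim/quotW=> c; rewrite !piE mulgA. Qed.

Lemma reduced_mul1g : left_id (\pi_reduced 1) reduced_mul.
Proof. by elim/quotW=> a; rewrite piE mul1g. Qed.

Lemma reduced_mulg1 : right_id (\pi_reduced 1) reduced_mul.
Proof. by elim/quotW=> a; rewrite piE mulg1. Qed.

HB.instance Definition _ :=
  isMonoid.Build reduced reduced_mulA reduced_mul1g reduced_mulg1.

End Reduced.

Section Elasticity.
Variable R : realType.
Local Open Scope ring_scope.

(* max L / min L is meant for finite nonempty L, where sup and inf are attained;
   the value on other sets is junk. *)
Definition elasticity (L : set nat) : R :=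
  if `[< L = [set 0%N] >] then 1
  else sup [set k%:R | k in L] / inf [set k%:R | k in L].

Variable H : monoidType.

Definition elasticities : set R := [set elasticity L | L in system_of_lengths H].

Definition monoid_elasticity : \bar R := ereal_sup (EFin @` elasticities).

Definition fully_elastic : Prop :=
  forall q : rat, 1 < q -> ((ratr q)%:E < monoid_elasticity)%E ->
    exists2 L, system_of_lengths H L & elasticity L = ratr q.

Definition asymptotic_elasticity (a : H) : R :=
  limn (fun n => elasticity (set_of_lengths (a ^+ n)%g)).

(* This set is empty exactly when H is a group; its ereal_inf is then +oo. *)
Definition asymptotic_elasticities : set R :=
  [set asymptotic_elasticity a | a in ~` @monoid_unit H].

End Elasticity.
Arguments elasticities : clear implicits.
Arguments asymptotic_elasticities : clear implicits.

(* Main.v *)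
Require Import Defs.
From HB Require Import structures.
From mathcomp Require Import all_boot all_order all_algebra generic_quotient.
From mathcomp Require Import all_classical all_reals all_analysis.
From mathcomp Require Import zify.
Import Order.TTheory GRing.Theory Num.Theory.
Import numFieldNormedType.Exports.

(** The reduced monoid M of H is generated by a finite set E of atoms, and the
    lengths of a in H are the lengths of the words over E whose product is the
    class of a.  Write max x and min x for the largest and smallest such length
    of x in M; everything rests on the inequalities
    max x + max y <= max (x y) and min (x y) <= min x + min y.

    Finiteness.  Consider the triples (z, v, w) where z is a word over a fixed
    finite set C, v and w are words over E, and the three products agree.
    By cancellation, a triple contained letterwise in another one can be
    subtracted from it.  Dickson's lemma [finite_domination] then shows that a
    ratio of two additive functions attains its minimum over all triples
    [min_ratio_attained]; this remains true for the triples with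
    p |w| <= d |v| [factor_triples_min_ratio].  Taking for this ratio
    |w| / |v| shows that the elasticity of M is finite and attained (C = E),
    and that some power a^N has the largest elasticity among the powers of a
    (C = {a}).  The elasticities of the powers of a converge to this largest
    value, so the asymptotic elasticity of a is the elasticity of a^N.

    The minimum r.  By the two inequalities above, the set of x with
    p min x <= d max x is closed under products.  Hence a lower bound for the
    asymptotic elasticities of the finitely many atoms is a lower bound for all
    of them, and r = P / Q is the asymptotic elasticity of some atom e.

    The interval.  Let q = p / d lie between r and the elasticity of M.  No power
    of e satisfies p min < d max, but an element b of largest elasticity
    satisfies p min b <= d max b.  Among the nonempty words z whose product
    satisfies p min <= d max choose one with the smallest proportion of letters different
    from e.  If its product c had p min c < d max c, then e c^p would still
    satisfy p min <= d max with an even smaller proportion; if the proportion is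
    0, then c is a power of e and p min c >= d max c.  Thus p min c = d max c,
    and c has elasticity q [balanced_element].

    Below r.  For some constant k, all x satisfy P min x <= Q max x + k
    [high_up_to_constant].  If the elasticity of x is at most r - t for a fixed
    t > 0, this bounds min x, hence also max x, and only finitely many values
    remain [finite_elast_below].  So no limit point lies below r.  If M is fully
    elastic and r > 1, all rationals in (1, r) are elasticities, so that every
    point of (1, r) would be such a limit point. *)

Set Implicit Arguments.
Unset Strict Implicit.
Unset Printing Implicit Defensive.

Local Open Scope classical_set_scope.

Local Notation prodw w := (\prod_(y <- w) y)%g.

(** * Dickson's lemma and minimal ratios *)

(** Dickson's lemma, with the coordinates given by a list of functions rather
    than by vectors, so that it applies to triples of words through their letter
    counts.  In the induction on the list, an element a either has f a >= N, for a
    bound N of f on a dominating set for the remaining functions, or lies in one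
    of the finitely many slices f = m with m < N. *)
Lemma finite_domination (X : choiceType) (fs : seq (X -> nat)) (A : set X) :
  exists2 B : seq X, {in B, forall b, A b} &
    forall a, A a -> exists2 b, b \in B & all (fun f => f b <= f a)%N fs.
Proof.
elim: fs A => [|f fs IH] A.
  have [[a Aa]|noA] := pselect (exists a, A a).
    by exists [:: a] => [b|a' _]; [rewrite inE => /eqP->|exists a; rewrite ?inE].
  by exists [::] => // a Aa; case: noA; exists a.
have [B1 B1A domB1] := IH A.
pose N := (\max_(b <- B1) f b)%N.
have fN b : b \in B1 -> (f b <= N)%N by move=> bB; rewrite /N leq_bigmax_seq.
have slices m : exists2 B : seq X, {in B, forall b, A b} &
    forall a, A a -> (f a < m)%N ->
      exists2 b, b \in B & all (fun g => g b <= g a)%N (f :: fs).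
  elim: m => [|m [B BA domB]]; first by exists [::].
  have [B' B'A domB'] := IH [set a | A a /\ f a = m].
  exists (B ++ B') => [b|a Aa].
    by rewrite mem_cat => /orP[/BA//|/B'A[]].
  rewrite ltnS leq_eqVlt => /orP[/eqP fam|/(domB a Aa)[b bB ab]].
    have [b bB' ab] := domB' a (conj Aa fam).
    exists b; first by rewrite mem_cat bB' orbT.
    by rewrite /= ab andbT fam; case: (B'A b bB') => _ ->.
  by exists b; rewrite // mem_cat bB.
have [B2 B2A domB2] := slices N.
exists (B1 ++ B2) => [b|a Aa].
  by rewrite mem_cat => /orP[/B1A|/B2A].
have [Nfa|faN] := leqP N (f a).
  have [b bB ab] := domB1 a Aa; exists b; first by rewrite mem_cat bB.
  by rewrite /= ab (leq_trans (fN b bB)).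
have [b bB ab] := domB2 a Aa faN.
by exists b; rewrite // mem_cat bB orbT.
Qed.

Lemma min_ratio_seq (X : choiceType) (p q : X -> nat) (b0 : X) (B : seq X) :
  {in b0 :: B, forall b, 0 < q b}%N ->
  exists2 b, b \in b0 :: B & {in b0 :: B, forall c, p b * q c <= p c * q b}%N.
Proof.
elim: B b0 => [|b1 B IH] b0 q_gt0.
  by exists b0; rewrite ?mem_head// => c; rewrite inE => /eqP->.
have [b bB minb] := IH b1 (fun c cB => q_gt0 c (mem_behead (s := _ :: _) cB)).
have qb : (0 < q b)%N by apply: q_gt0; rewrite inE bB orbT.
have qb0 : (0 < q b0)%N by apply: q_gt0; rewrite mem_head.
have [le_bb0|lt_b0b] := leqP (p b * q b0)%N (p b0 * q b)%N.
  by exists b => [|c]; rewrite inE ?bB ?orbT// => /orP[/eqP->|/minb].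
exists b0 => [|c]; rewrite inE ?eqxx// => /orP[/eqP->//|cB].
have le_bc := minb c cB.
rewrite -(leq_pmul2r qb) mulnAC (leq_trans (leq_mul (ltnW lt_b0b) (leqnn _)))//.
by rewrite mulnAC [leqRHS]mulnAC leq_pmul2r.
Qed.

(** A minimum of p / q over a finite dominating set of the t with q t > 0 is
    global: an element b of that set below t can be subtracted from t, and p / q at
    t is a mediant of its values at b and at the difference, where induction on q applies. *)
Lemma min_ratio_attained (X : choiceType) (fs : seq (X -> nat)) (T : set X)
    (p q : X -> nat) :
  (forall t t', T t -> T t' -> all (fun f => f t' <= f t)%N fs ->
     exists2 t'', T t'' & p t = (p t' + p t'')%N /\ q t = (q t' + q t'')%N) ->
  (exists2 t, T t & 0 < q t)%N ->
  exists2 t0, T t0 & (0 < q t0)%N /\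
    forall t, T t -> (p t0 * q t <= p t * q t0)%N.
Proof.
move=> subT [t1 Tt1 qt1].
have [B BA domB] := finite_domination fs [set t | T t /\ (0 < q t)%N].
have [b1 b1B _] := domB t1 (conj Tt1 qt1).
have [|t0 t0B mint0] := @min_ratio_seq _ p q b1 B.
  by move=> b; rewrite inE => /orP[/eqP->|/BA[]//]; case: (BA b1 b1B).
have {}t0B : t0 \in B by move: t0B; rewrite inE => /orP[/eqP->|].
have [Tt0 qt0] := BA t0 t0B.
exists t0 => //; split=> // t.
have [n] := ubnP (q t); elim: n t => // n IH t qtn Tt.
have [->|qt] := posnP (q t); first by rewrite muln0.
have [b bB /(subT t b Tt (BA b bB).1)[t' Tt' [-> eq_qt]]] := domB t (conj Tt qt).
have := mint0 b; rewrite inE bB orbT => /(_ isT) mb.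
have := IH t'; rewrite eq_qt mulnDl mulnDr.
have [_ qb] := BA b bB.
by move=> /(_ _ Tt')/(leq_add mb)-> //; lia.
Qed.


(** * Words and their products *)

Section Lengths.
Variable M : cancelComMonoidType.
Local Open Scope group_scope.

HB.instance Definition _ := SemiGroup.isCommutativeLaw.Build M *%g (@ccmulC M).

Implicit Types (x y a b c : M) (v w z C : seq M).

Lemma mul_cancel x a b : x * a = x * b -> a = b.
Proof. exact: (@ccmulI M). Qed.

Lemma prod_cat v w :
  prodw (v ++ w) = prodw v * prodw w.
Proof. exact: big_cat. Qed.

Lemma prod_perm v w : perm_eq v w -> prodw v = prodw w.
Proof. exact: perm_big. Qed.

Lemma prod_nseq n x : prodw (nseq n x) = x ^+ n.
Proof. by elim: n => [|n IH]; rewrite ?big_nil// big_cons IH expgS. Qed.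

Lemma prod_flatten_nseq n w :
  prodw (flatten (nseq n w)) = (prodw w) ^+ n.
Proof. by elim: n => [|n IH]; rewrite /= ?big_nil// prod_cat IH expgS. Qed.

Lemma mul_expg x y n : (x * y) ^+ n = x ^+ n * y ^+ n.
Proof. by apply: expgMn; apply: ccmulC. Qed.

(** Only the letters in E have to be compared, which makes containment of words a
    finite list of inequalities. *)
Lemma count_cancel (E : seq M) v w : {subset v <= E} -> {subset w <= E} ->
  all (fun e => count_mem e v <= count_mem e w)%N E ->
  exists2 w', {subset w' <= E} & perm_eq w (v ++ w').
Proof.
move=> vE wE /allP le_vw.
have /count_subseqP[v' sub_v' eq_vv'] : forall e, (count_mem e v <= count_mem e w)%N.
  move=> e; have [/le_vw//|eE] := boolP (e \in E).
  by rewrite (count_memPn _)//; apply: contra eE => /vE.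
have [w' eq_w] := perm_to_subseq sub_v'.
have {}eq_w : perm_eq w (v ++ w').
  by rewrite (perm_trans eq_w)// perm_cat2r perm_sym.
by exists w' => // e ew'; apply: wE; rewrite (perm_mem eq_w) mem_cat ew' orbT.
Qed.

Variable E : seq M.

Definition factorization x w := {subset w <= E} /\ prodw w = x.

(** The condition on p and d cuts out the triples that witness an elasticity of
    at least p / d; it is void for p = 0. *)
Definition factor_triples (C : seq M) (p d : nat) :
    set (seq M * seq M * seq M) :=
  [set t | [/\ {subset t.1.1 <= C},
     factorization (prodw t.1.1) t.1.2,
     factorization (prodw t.1.1) t.2
   & (p * size t.2 <= d * size t.1.2)%N]].

(** The letters of a triple are subtracted up to reordering, hence additivity is
    required only up to permutation. *)
Definition perm_additive (f : seq M * seq M * seq M -> nat) :=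
  forall t t' t'', perm_eq t.1.1 (t'.1.1 ++ t''.1.1) ->
    perm_eq t.1.2 (t'.1.2 ++ t''.1.2) -> perm_eq t.2 (t'.2 ++ t''.2) ->
    f t = (f t' + f t'')%N.

(** Besides the letter counts, the slack d |v| - p |w| is one of the coordinates
    to be dominated: then the difference of two triples has nonnegative slack. *)
Lemma factor_triples_min_ratio C p d f g :
  perm_additive f -> perm_additive g ->
  (exists2 t, factor_triples C p d t & 0 < g t)%N ->
  exists2 t0, factor_triples C p d t0 & (0 < g t0)%N /\
    forall t, factor_triples C p d t -> (f t0 * g t <= f t * g t0)%N.
Proof.
move=> f_add g_add.
pose fs : seq (seq M * seq M * seq M -> nat) :=
  (fun t => d * size t.1.2 - p * size t.2)%N ::
  [seq (fun t => count_mem e t.1.1) | e <- C] ++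
  [seq (fun t => count_mem e t.1.2) | e <- E] ++
  [seq (fun t => count_mem e t.2) | e <- E].
apply: (min_ratio_attained (fs := fs)) => t t'.
move=> [tC [tE1 tP1] [tE2 tP2] tpd] [t'C [t'E1 t'P1] [t'E2 t'P2] t'pd].
rewrite /= !all_cat !all_map => /and4P[slack le0 le1 le2].
have [z zC perm_z] := count_cancel t'C tC le0.
have [v vE perm_v] := count_cancel t'E1 tE1 le1.
have [w wE perm_w] := count_cancel t'E2 tE2 le2.
exists (z, v, w); last by split; [exact: f_add|exact: g_add].
split=> //=.
- split=> //; apply: (@mul_cancel (prodw t'.1.2)).
  by rewrite -prod_cat -(prod_perm perm_v) tP1 (prod_perm perm_z) prod_cat t'P1.
- split=> //; apply: (@mul_cancel (prodw t'.2)).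
  by rewrite -prod_cat -(prod_perm perm_w) tP2 (prod_perm perm_z) prod_cat t'P2.
- move: tpd t'pd slack; rewrite (perm_size perm_v) (perm_size perm_w) !size_cat.
  rewrite !mulnDr.
  move: (p * size t'.2)%N (p * size w)%N (d * size t'.1.2)%N (d * size v)%N.
  by move=> *; lia.
Qed.

Lemma factorization_nil : factorization 1 [::].
Proof. by split=> //; rewrite big_nil. Qed.

Lemma factorization_cat x y v w : factorization x v -> factorization y w ->
  factorization (x * y) (v ++ w).
Proof.
move=> [vE <-] [wE <-]; split; last exact: prod_cat.
by move=> e; rewrite mem_cat => /orP[/vE|/wE].
Qed.

Lemma factorization_seq1 e : e \in E -> factorization e [:: e].
Proof. by move=> eE; split; rewrite ?big_seq1// => ?; rewrite inE => /eqP->. Qed.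

(** * Extremal lengths and elasticities *)
Definition is_maxlen x k :=
  (exists2 w, factorization x w & size w = k) /\
  forall w, factorization x w -> (size w <= k)%N.

Definition is_minlen x k :=
  (exists2 w, factorization x w & size w = k) /\
  forall w, factorization x w -> (k <= size w)%N.

Definition maxlen x := xget 0%N (is_maxlen x).

Definition minlen x := xget 0%N (is_minlen x).

Hypothesis genE : forall x, exists w, factorization x w.
Hypothesis conE : forall w, factorization 1 w -> w = [::].

Lemma factorization_neq1 x w : factorization x w -> x <> 1 -> (0 < size w)%N.
Proof. by case: w => // -[_ <-]; rewrite big_nil. Qed.

(** Maximising |v| / |w| is minimising |w| / |v|; the latter form has a positive
    denominator as soon as the product is not 1. *)
Lemma factorization_max_ratio (C : seq M) :
  (exists2 z, {subset z <= C} & prodw z <> 1) ->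
  exists z0 v0 w0, [/\ {subset z0 <= C}, prodw z0 <> 1,
    factorization (prodw z0) v0, factorization (prodw z0) w0 &
    forall z v w, {subset z <= C} ->
      factorization (prodw z) v -> factorization (prodw z) w ->
      (size v * size w0 <= size v0 * size w)%N].
Proof.
move=> [z1 z1C z1N1]; have [v1 v1P] := genE (prodw z1).
pose f (t : seq M * seq M * seq M) := size t.2.
pose g (t : seq M * seq M * seq M) := size t.1.2.
have [t t' t''|t t' t''||] := @factor_triples_min_ratio C 0 0 f g.
- by move=> _ _ /perm_size; rewrite size_cat.
- by move=> _ /perm_size; rewrite size_cat.
- by exists (z1, v1, v1) => //; exact: factorization_neq1 z1N1.
move=> [[z0 v0] w0] [/= z0C v0P w0P _] [g_gt0 min0].
exists z0, v0, w0; split=> //.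
  by move=> z0E; move: v0P g_gt0; rewrite z0E => /conE; rewrite /g /= => ->.
move=> z v w zC vP wP; have := min0 (z, v, w).
by rewrite mulnC [leqRHS]mulnC; apply; split.
Qed.

Lemma factorization_bounded x :
  exists k, forall w, factorization x w -> (size w <= k)%N.
Proof.
have [->|xN1] := eqVneq x 1; first by exists 0%N => w /conE ->.
have [w wP] := genE x.
have [|z0 [v0 [w0 [_ z0N1 _ w0P max0]]]] := @factorization_max_ratio E.
  by exists w; [case: wP|rewrite wP.2; exact/eqP].
exists (size v0 * size w)%N => v vP.
rewrite -(muln1 (size v)).
have := max0 w v w wP.1; rewrite wP.2 => /(_ vP wP); apply: leq_trans.
by rewrite leq_mul2l (factorization_neq1 w0P z0N1) orbT.
Qed.

Lemma maxlenP x : is_maxlen x (maxlen x).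
Proof.
have [w wP] := genE x; have [k bnd_k] := factorization_bounded x.
pose P := [pred n | `[< exists2 w, factorization x w & size w = n >]].
have exP : exists n, P n by exists (size w); apply/asboolP; exists w.
have bndP n : P n -> (n <= k)%N by move=> /asboolP[v /bnd_k vk <-].
case: (ex_maxnP exP bndP) => n /asboolP nP max_n.
apply: xgetPex; exists n; split=> // v vP.
by apply: max_n; apply/asboolP; exists v.
Qed.

Lemma minlenP x : is_minlen x (minlen x).
Proof.
have [w wP] := genE x.
pose P := [pred n | `[< exists2 w, factorization x w & size w = n >]].
have exP : exists n, P n by exists (size w); apply/asboolP; exists w.
case: (ex_minnP exP) => n /asboolP nP min_n.
apply: xgetPex; exists n; split=> // v vP.
by apply: min_n; apply/asboolP; exists v.
Qed.

Lemma minlen_le_maxlen x : (minlen x <= maxlen x)%N.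
Proof. by have [[w wP <-] _] := maxlenP x; apply: (minlenP x).2. Qed.

Lemma maxlenM x y : (maxlen x + maxlen y <= maxlen (x * y)%g)%N.
Proof.
have [[v vP <-] _] := maxlenP x; have [[w wP <-] _] := maxlenP y.
by rewrite -size_cat; apply: (maxlenP _).2; apply: factorization_cat.
Qed.

Lemma minlenM x y : (minlen (x * y)%g <= minlen x + minlen y)%N.
Proof.
have [[v vP <-] _] := minlenP x; have [[w wP <-] _] := minlenP y.
by rewrite -size_cat; apply: (minlenP _).2; apply: factorization_cat.
Qed.

Lemma maxlen1 : maxlen 1 = 0%N.
Proof. by have [[w /conE-> <-]] := maxlenP 1. Qed.

Lemma minlen1 : minlen 1 = 0%N.
Proof. by have [[w /conE-> <-]] := minlenP 1. Qed.

Lemma minlen_gt0 x : x <> 1 -> (0 < minlen x)%N.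
Proof.
by move=> xN1; have [[w wP <-] _] := minlenP x; apply: factorization_neq1 xN1.
Qed.

Lemma maxlenX x n : (n * maxlen x <= maxlen (x ^+ n)%g)%N.
Proof.
elim: n => // n IH; rewrite mulSn expgS.
exact: leq_trans (leq_add (leqnn _) IH) (maxlenM _ _).
Qed.

Lemma minlenX x n : (minlen (x ^+ n)%g <= n * minlen x)%N.
Proof.
elim: n => [|n IH]; first by rewrite expg0 minlen1.
rewrite mulSn expgS.
exact: leq_trans (minlenM _ _) (leq_add (leqnn _) IH).
Qed.

Lemma expg_neq1 x n : x <> 1 -> (0 < n)%N -> x ^+ n <> 1.
Proof.
move=> xN1 n0 xn1; have := maxlenX x n; rewrite xn1 maxlen1 leqn0 muln_eq0.
by rewrite -!leqn0 leqNgt n0/= leqNgt (leq_trans (minlen_gt0 xN1))// minlen_le_maxlen.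
Qed.

(** With C = E this is the elasticity of M, with C = {a} the largest elasticity of
    a power of a. *)
Lemma max_elasticity_attained (C : seq M) :
  (exists2 z, {subset z <= C} & prodw z <> 1) ->
  exists2 z0, {subset z0 <= C} & prodw z0 <> 1 /\
    forall z, {subset z <= C} ->
      (maxlen (prodw z) * minlen (prodw z0) <=
       maxlen (prodw z0) * minlen (prodw z))%N.
Proof.
move=> /factorization_max_ratio[z0 [v0 [w0 [z0C z0N1 v0P w0P max0]]]].
exists z0 => //; split=> // z zC.
set a := prodw z; set a0 := prodw z0 in z0N1 v0P w0P max0 *.
have [[v vP <-] _] := maxlenP a; have [[w wP <-] _] := minlenP a.
have := max0 z v w zC vP wP.
have := (maxlenP a0).2 _ v0P; have := (minlenP a0).2 _ w0P.
move=> le_w0 le_v0 le_vw; apply: leq_trans (leq_mul le_v0 (leqnn _)).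
by apply: leq_trans le_vw; rewrite leq_mul2l le_w0 orbT.
Qed.

Lemma subset_seq1 a z : {subset z <= [:: a]} -> z = nseq (size z) a.
Proof. by move=> za; apply/all_pred1P/allP => e /za; rewrite inE. Qed.

Lemma power_max_elasticity a : a <> 1 ->
  exists2 N, (0 < N)%N & forall n,
    (maxlen (a ^+ n)%g * minlen (a ^+ N)%g <= maxlen (a ^+ N)%g * minlen (a ^+ n)%g)%N.
Proof.
move=> aN1; have [|z0 z0a [z0N1 max0]] := @max_elasticity_attained [:: a].
  by exists [:: a]; rewrite ?big_seq1.
move: z0N1 max0; rewrite (subset_seq1 z0a) prod_nseq => z0N1 max0.
exists (size z0); first by case: (size z0) z0N1.
move=> n; have := max0 (nseq n a); rewrite prod_nseq; apply.
by move=> e /nseqP[->]; rewrite mem_head.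
Qed.

(** The element c lies on the line p min = d max because it is extremal among the
    elements on one side of that line.  The element a only has to have all its
    powers on the other side. *)
Lemma balanced_element a p d : a \in E ->
  (forall n, d * maxlen (a ^+ n)%g <= p * minlen (a ^+ n)%g)%N ->
  (exists2 b, b <> 1 & (p * minlen b <= d * maxlen b)%N) ->
  exists2 c, c <> 1 & (p * minlen c = d * maxlen c)%N.
Proof.
move=> aE a_low [b bN1 b_high].
(* f / g is the proportion of letters different from a in the word z. *)
pose f (t : seq M * seq M * seq M) := count (predC1 a) t.1.1.
pose g (t : seq M * seq M * seq M) := size t.1.1.
have triple z : {subset z <= E} ->
    (p * minlen (prodw z) <= d * maxlen (prodw z))%N ->
    exists v w, factor_triples E p d (z, v, w).
  move=> zE; set x := prodw z.
  have [[v vP <-] _] := maxlenP x; have [[w wP <-] _] := minlenP x.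
  by exists v, w; split.
have [t t' t''|t t' t''||] := @factor_triples_min_ratio E p d f g.
- by move=> /permP/(_ (predC1 a)); rewrite count_cat.
- by move=> /perm_size; rewrite size_cat.
- have [z zP] := genE b; have [||v [w t_vw]] := triple z; first by case: zP.
    by rewrite zP.2.
  by exists (z, v, w) => //; apply: factorization_neq1 zP bN1.
move=> [[z v] w] [/= zE vP wP pd_vw]; rewrite /f /g /= => -[z_gt0 min0].
set c := prodw z in vP wP.
have cN1 : c <> 1 by move=> c1; rewrite (conE (conj zE c1)) in z_gt0.
have c_high : (p * minlen c <= d * maxlen c)%N.
  have := (minlenP c).2 _ wP; have := (maxlenP c).2 _ vP => le_v le_w.
  apply: leq_trans (leq_trans pd_vw _); first by rewrite leq_mul2l le_w orbT.
  by rewrite leq_mul2l le_v orbT.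
exists c => //; apply/eqP; rewrite eqn_leq c_high /= leqNgt; apply/negP => c_gt.
have [z_a|z_Na] := posnP (count (predC1 a) z).
  have z_nseq : z = nseq (size z) a.
    apply/all_pred1P; move/eqP: z_a; rewrite -leqn0 leqNgt -has_count.
    by rewrite has_predC negbK.
  by move: c_gt; rewrite /c z_nseq prod_nseq ltnNge a_low.
(* The strict inequality at c leaves room for one extra letter a in c^p. *)
have z'E : {subset a :: flatten (nseq p z) <= E}.
  move=> e; rewrite inE => /orP[/eqP->//|/flattenP[z' /nseqP[-> _]]]; exact: zE.
have [||v' [w' /min0/=]] := triple (a :: flatten (nseq p z)) => //.
  rewrite big_cons prod_flatten_nseq -/c.
  have minlen_a : (minlen a <= 1)%N.
    exact: (minlenP a).2 _ (factorization_seq1 aE).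
  have le_min : (minlen (a * c ^+ p)%g <= (p * minlen c).+1)%N.
    by rewrite (leq_trans (minlenM _ _))// -add1n leq_add// minlenX.
  have le_max : (p * maxlen c <= maxlen (a * c ^+ p)%g)%N.
    by rewrite (leq_trans (maxlenX _ _))// (leq_trans _ (maxlenM _ _))// leq_addl.
  rewrite (leq_trans (leq_mul (leqnn p) le_min))//.
  rewrite (leq_trans (leq_mul (leqnn p) c_gt))//.
  by rewrite mulnCA leq_mul2l le_max orbT.
rewrite eqxx count_flatten size_flatten /shape !map_nseq !sumn_nseq.
rewrite add0n mulnS mulnAC -mulnA -[leqRHS]add0n leq_add2r leqn0.
by rewrite gtn_eqF.
Qed.

(** * Propagating a lower bound from the generators *)
Section LowerBound.
Variables (p d : nat).
Hypothesis E_power : forall e, e \in E ->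
  exists2 N, (0 < N)%N & (p * minlen (e ^+ N)%g <= d * maxlen (e ^+ N)%g)%N.

Let high x := (p * minlen x <= d * maxlen x)%N.

Lemma highM x y : high x -> high y -> high (x * y).
Proof. by rewrite /high; have := minlenM x y; have := maxlenM x y; nia. Qed.

Lemma highX x n : high x -> high (x ^+ n).
Proof.
move=> hx; elim: n => [|n IH]; last by rewrite expgS; apply: highM.
by rewrite /high expg0 minlen1 muln0.
Qed.

(** A product of suitable exponents suits all generators, as the inequality
    passes to powers. *)
Lemma common_power : exists2 N, (0 < N)%N & {in E, forall e, high (e ^+ N)}.
Proof.
have : {subset E <= E} by [].
elim: {1 3}E => [|e s IH] sE; first by exists 1%N.
have [e' e's|N N0 highN] := IH; first by apply: sE; rewrite inE e's orbT.
have [K K0 highK] := E_power (sE e (mem_head _ _)).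
exists (N * K)%N => [|e']; first by rewrite muln_gt0 N0.
rewrite inE => /orP[/eqP->|/highN].
  by rewrite mulnC expgnA; apply: highX.
by rewrite expgnA; apply: highX.
Qed.

Lemma high_power : exists2 N, (0 < N)%N & forall x, high (x ^+ N).
Proof.
have [N N0 highN] := common_power; exists N => // x.
have [w [wE <-]] := genE x; elim: w wE => [|e w IH] wE.
  by rewrite big_nil expg1n /high minlen1 muln0.
rewrite big_cons mul_expg; apply: highM; first exact/highN/wE/mem_head.
by apply: IH => e' e'w; apply: wE; rewrite inE e'w orbT.
Qed.

(** In a word, the occurrences of each generator e are grouped into blocks e^N,
    which satisfy the inequality; fewer than N copies of each e are left over, and
    they cost at most p N each in p min. *)
Lemma high_up_to_constant : exists k, forall x,
  (p * minlen x <= d * maxlen x + k)%N.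
Proof.
have [N N0 highN] := common_power.
suff [k kP] : exists k, forall w, {subset w <= E} ->
    (p * minlen (prodw w) <= d * maxlen (prodw w) + k)%N.
  by exists k => x; have [w [wE <-]] := genE x; apply: kP.
have : {subset E <= E} by [].
elim: {1 3}E => [|e s IH] sE.
  by exists 0%N => -[|e w /(_ e (mem_head _ _))]//; rewrite big_nil minlen1 muln0.
have [e' e's|k kP] := IH; first by apply: sE; rewrite inE e's orbT.
have eE : e \in E by apply: sE; rewrite mem_head.
exists (p * N + k)%N => w ws.
set w' := seq.filter (predC1 e) w; set n := count_mem e w.
have w's : {subset w' <= s}.
  by move=> e'; rewrite mem_filter /= => /andP[+ /ws]; rewrite inE => /negPf->.
have -> : prodw w = e ^+ n * prodw w'.
  rewrite -prod_nseq -prod_cat; apply: prod_perm; rewrite perm_sym.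
  have -> : nseq n e = seq.filter (pred1 e) w.
    by rewrite /n -size_filter; apply/esym/all_pred1P/filter_all.
  by rewrite perm_filterC.
rewrite (divn_eq n N) expgnDr [(n %/ N * N)%N]mulnC expgnA.
have hq := highX (n %/ N) (highN e eE).
set u := (e ^+ N) ^+ _ in hq *; set r := (n %% N)%N.
have rN : (r < N)%N by rewrite ltn_mod.
have minlen_e : (minlen e <= 1)%N.
  exact: (minlenP e).2 _ (factorization_seq1 eE).
set x := prodw w'; have le_x := kP w' w's; rewrite -/x in le_x.
have le_min : (minlen (u * e ^+ r * x)%g <= minlen u + N + minlen x)%N.
  rewrite (leq_trans (minlenM _ _))// leq_add2r (leq_trans (minlenM _ _))//.
  rewrite leq_add2l (leq_trans (minlenX _ _))//.
  by rewrite (leq_trans (leq_mul (ltnW rN) minlen_e))// muln1.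
have le_max : (maxlen u + maxlen x <= maxlen (u * e ^+ r * x)%g)%N.
  rewrite (leq_trans _ (maxlenM _ _))// leq_add2r (leq_trans _ (maxlenM _ _))//.
  exact: leq_addr.
apply: leq_trans (leq_mul (leqnn p) le_min) _.
apply: (@leq_trans (d * (maxlen u + maxlen x) + (p * N + k))%N).
  move: hq; rewrite /high !mulnDr => hq; lia.
by rewrite leq_add2r leq_mul2l le_max orbT.
Qed.

End LowerBound.
End Lengths.

(** * Elasticities of powers *)
Section LeastAsymptotic.
Variable M : cancelComMonoidType.
Variable E : seq M.
Hypothesis genE : forall x, exists w, factorization E x w.
Hypothesis conE : forall w, factorization E 1%g w -> w = [::].
Local Open Scope group_scope.
Local Notation maxlen := (maxlen E).
Local Notation minlen := (minlen E).

Lemma letter_neq1 e : e \in E -> e <> 1.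
Proof.
move=> eE e1; suff /conE : factorization E 1 [:: e] by [].
by rewrite -e1; apply: factorization_seq1.
Qed.

(** Every generator u has a power u^K of largest elasticity; e is the generator
    for which this elasticity is smallest. *)
Lemma least_power_elasticity : (exists x : M, x <> 1) ->
  exists2 e, e \in E & exists2 N, (0 < N)%N &
    (forall n, maxlen (e ^+ n) * minlen (e ^+ N) <=
               maxlen (e ^+ N) * minlen (e ^+ n))%N /\
    {in E, forall u, exists2 K, (0 < K)%N &
      (maxlen (e ^+ N) * minlen (u ^+ K) <=
       minlen (e ^+ N) * maxlen (u ^+ K))%N}.
Proof.
move=> [x xN1].
have exN e : exists N, e <> 1 -> (0 < N)%N /\ forall n,
    (maxlen (e ^+ n) * minlen (e ^+ N) <= maxlen (e ^+ N) * minlen (e ^+ n))%N.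
  have [->|/eqP eN1] := eqVneq e 1; first by exists 1%N.
  by have [N N0 NP] := power_max_elasticity genE conE eN1; exists N.
have [N NP] := choice exN.
have NE e (eE : e \in E) := NP e (letter_neq1 eE).
have [w wP] := genE x.
have [e0 [E' E_eq]] : exists e0 E', E = e0 :: E'.
  case: w wP => [[_]|e w [wE _]]; first by rewrite big_nil => /esym.
  by have := wE e (mem_head _ _); case: (E) => // e0 E'; exists e0, E'.
have [|e eE mine] := @min_ratio_seq _ (fun e => maxlen (e ^+ N e))
  (fun e => minlen (e ^+ N e)) e0 E'.
  move=> e; rewrite -E_eq => eE; apply: minlen_gt0 => //; apply: expg_neq1 => //.
    exact: letter_neq1.
  by case: (NE e eE).
rewrite -E_eq in eE mine.
exists e => //; have [N0 maxN] := NE e eE; exists (N e) => //; split=> // u uE.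
by exists (N u); [case: (NE u uE)|rewrite [leqRHS]mulnC mine].
Qed.

(** For n = q N + s with s < N, the factor (x^N)^q contributes equally to both
    sides and x^s only a bounded amount.  This is what makes the elasticities of
    x^n converge to the one of x^N. *)
Lemma power_defect x N : (0 < N)%N -> exists k, forall n,
  (maxlen (x ^+ N) * minlen (x ^+ n) <= minlen (x ^+ N) * maxlen (x ^+ n) + k)%N.
Proof.
move=> N0; set P := maxlen (x ^+ N); set Q := minlen (x ^+ N).
exists (P * (N * minlen x))%N => n.
set q := (n %/ N)%N; set s := (n %% N)%N.
have sN : (s <= N)%N by rewrite ltnW// ltn_mod.
have xn : x ^+ n = (x ^+ N) ^+ q * x ^+ s.
  by rewrite {1}(divn_eq n N) expgnDr [(_ %/ _ * _)%N]mulnC expgnA.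
have le_min : (minlen (x ^+ n) <= q * Q + N * minlen x)%N.
  rewrite xn (leq_trans (minlenM genE _ _))// leq_add// ?minlenX//.
  by rewrite (leq_trans (minlenX genE conE _ _))// leq_mul2r sN orbT.
have le_max : (q * P <= maxlen (x ^+ n))%N.
  rewrite xn (leq_trans (maxlenX genE conE _ _))//.
  by rewrite (leq_trans _ (maxlenM genE conE _ _))// leq_addr.
apply: leq_trans (leq_mul (leqnn P) le_min) _; rewrite mulnDr leq_add2r.
by rewrite mulnA mulnC leq_mul2l [(P * q)%N]mulnC le_max orbT.
Qed.

End LeastAsymptotic.

(** * Finitely generated conical monoids have finitely many atoms *)
Section Atoms.
Variable M : cancelComMonoidType.
Local Open Scope group_scope.
Hypothesis conical : forall x y : M, x * y = 1 -> x = 1.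

Lemma conical_r (x y : M) : x * y = 1 -> y = 1.
Proof. by rewrite ccmulC => /conical. Qed.

(** A generating list of smallest size will do: no generator e is a product of
    other generators, so in a proper splitting e = y z the letter e occurs in a
    word for y or for z, and cancelling it makes the other factor trivial. *)
Lemma atom_basis : finitely_generated M ->
  exists E : seq M, [/\ forall x, exists w, factorization E x w,
    forall w, factorization E 1 w -> w = [::] &
    {in E, forall x y z, x = y * z -> y = 1 \/ z = 1}].
Proof.
move=> [E0 genE0].
pose gen (E : seq M) := forall x, exists w, factorization E x w.
pose P := [pred n | `[< exists2 E, gen E & size E = n >]].
have exP : exists n, P n.
  exists (size E0); apply/asboolP; exists E0 => // x.
  by have [w wE xw] := genE0 x; exists w.
case: (ex_minnP exP) => _ /asboolP[E genE <-] minE.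
have irredundant e v : e \in E -> factorization E e v -> e \in v.
  move=> eE [vE ev]; apply/negPn/negP => eNv.
  have v'E : {subset v <= rem e E}.
    move=> y yv; have := vE y yv; rewrite (perm_mem (perm_to_rem eE)) inE.
    by case: eqP => // y_e; rewrite -y_e yv in eNv.
  have : P (size (rem e E)).
    apply/asboolP; exists (rem e E) => // x; have [w [wE <-]] := genE x.
    elim: w wE => [|y w IH] wE; first by rewrite big_nil; exists [::]; apply: factorization_nil.
    have [|u uP] := IH; first by move=> z zw; apply: wE; rewrite inE zw orbT.
    rewrite big_cons.
    suff [u' u'P] : exists u', factorization (rem e E) y u'.
      by exists (u' ++ u); apply: factorization_cat.
    have := wE y (mem_head _ _); rewrite (perm_mem (perm_to_rem eE)) inE.
    move=> /orP[/eqP->|yE]; first by exists v.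
    by exists [:: y]; apply: factorization_seq1.
  move=> /minE; rewrite size_rem//; case: (E) eE => //= e0 E' _.
  by rewrite ltnn.
have atomE : {in E, forall x y z, x = y * z -> y = 1 \/ z = 1}.
  move=> e eE y z e_yz; have [v vP] := genE y; have [w wP] := genE z.
  have := factorization_cat vP wP; rewrite -e_yz => /(irredundant e _ eE).
  rewrite mem_cat => /orP[ev|ew].
  - right; have := prod_perm (perm_to_rem ev); rewrite vP.2 big_cons => y_e.
    apply: (@conical_r (prodw (rem e v))); apply: (@mul_cancel _ e).
    by rewrite mulg1 mulgA -y_e.
  - left; have := prod_perm (perm_to_rem ew); rewrite wP.2 big_cons => z_e.
    apply: (@conical _ (prodw (rem e w))); apply: (@mul_cancel _ e).
    by rewrite mulg1 mulgA [e * y]ccmulC -mulgA -z_e.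
exists E; split=> // -[//|e w] [wE]; rewrite big_cons => /conical e1.
have /(irredundant e) : factorization E e [::].
  by rewrite e1; apply: factorization_nil.
by move=> /(_ (wE e (mem_head _ _))).
Qed.

End Atoms.

(** * Lengths in a monoid and words in its reduced monoid *)
Section Bridge.
Variable H : cancelComMonoidType.
Local Open Scope group_scope.
Local Open Scope quotient_scope.

Lemma monoid_unitM (u v : H) : monoid_unit u -> monoid_unit v -> monoid_unit (u * v).
Proof.
move=> [u' [uu' u'u]] [v' [vv' v'v]]; exists (v' * u'); split.
  by rewrite mulgA -[u * v * v']mulgA vv' mulg1.
by rewrite mulgA -[v' * u' * u]mulgA u'u mulg1.
Qed.

Lemma monoid_unitMl (u v : H) : monoid_unit (u * v) -> monoid_unit u.
Proof.
move=> [w [uvw _]]; exists (v * w); rewrite mulgA uvw; split=> //.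
by rewrite ccmulC mulgA.
Qed.

Lemma monoid_unit1 : monoid_unit (1 : H).
Proof. by exists 1; rewrite mulg1. Qed.

Lemma pi_reduced_eq (a b : H) : \pi_(reduced H) a = \pi_(reduced H) b <->
  exists2 u, monoid_unit u & a = b * u.
Proof.
split=> [/pi_reducedP ab|[u uu ->]].
  have : unit_coset b a by rewrite -ab; exists 1; [exact: monoid_unit1|rewrite mulg1].
  by move=> [u uu <-]; exists u.
apply/pi_reducedP/seteqP; split=> c /= [v vu <-].
  by exists (u * v); [exact: monoid_unitM|rewrite mulgA].
have [u' [uu' u'u]] := uu; exists (u' * v); last by rewrite mulgA -[b * u * u']mulgA uu' mulg1.
by apply: monoid_unitM => //; exists u.
Qed.

Lemma pi_reducedM (a b : H) :
  \pi_(reduced H) (a * b) = \pi_(reduced H) a * \pi_(reduced H) b.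
Proof. exact: pi_reduced_mul. Qed.

Lemma pi_reduced1 : \pi_(reduced H) (1 : H) = 1.
Proof. by []. Qed.

Lemma pi_reducedX (a : H) n : \pi_(reduced H) (a ^+ n) = \pi_(reduced H) a ^+ n.
Proof. by elim: n => // n IH; rewrite !expgS pi_reducedM IH. Qed.

Lemma pi_reduced_eq1 (a : H) : \pi_(reduced H) a = 1 <-> monoid_unit a.
Proof.
rewrite -pi_reduced1; split=> [/pi_reduced_eq[u uu ->]|ua].
  by rewrite mul1g.
by apply/pi_reduced_eq; exists a; rewrite ?mul1g.
Qed.

Lemma reduced_mulC : commutative (fun x y : reduced H => x * y).
Proof.
by elim/quotW=> a; elim/quotW=> b; rewrite -!pi_reducedM ccmulC.
Qed.

Lemma reduced_mulI : right_injective (fun x y : reduced H => x * y).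
Proof.
elim/quotW=> a; elim/quotW=> b; elim/quotW=> c.
rewrite -!pi_reducedM => /pi_reduced_eq[u uu]; rewrite -mulgA => /mul_cancel bcu.
by apply/pi_reduced_eq; exists u.
Qed.

HB.instance Definition _ :=
  Monoid_isCancelCom.Build (reduced H) reduced_mulC reduced_mulI.

Lemma reduced_conical (x y : reduced H) : x * y = 1 -> x = 1.
Proof.
elim/quotW: x => a; elim/quotW: y => b; rewrite -pi_reducedM => /pi_reduced_eq1.
by move=> /monoid_unitMl/pi_reduced_eq1.
Qed.

Lemma pi_reduced_prod (s : seq H) :
  \pi_(reduced H) (prodw s) = prodw (map \pi_(reduced H) s).
Proof.
elim: s => [|a s IH]; first by rewrite !big_nil.
by rewrite big_cons /= big_cons pi_reducedM IH.
Qed.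

Variable E : seq (reduced H).
Hypothesis genE : forall x, exists w, factorization E x w.
Hypothesis conE : forall w, factorization E 1 w -> w = [::].
Hypothesis atomE : {in E, forall x y z, x = y * z -> y = 1 \/ z = 1}.

(** An atom of H that is written as a word over E can only be a one-letter word,
    because any longer word splits it into two non-units. *)
Lemma is_atomP (u : H) : is_atom u <-> \pi_(reduced H) u \in E.
Proof.
split=> [[uNunit u_atom]|uE].
  have [w wP] := genE (\pi_(reduced H) u); case: w wP => [|e w] [wE uw].
    by case: uNunit; apply/pi_reduced_eq1; rewrite -uw big_nil.
  have eE : e \in E by apply: wE; rewrite mem_head.
  suff w_nil : w = [::] by rewrite -uw w_nil big_seq1.
  apply: conE; split; first by move=> y yw; apply: wE; rewrite inE yw orbT.
  move: uw; rewrite big_cons -[e]reprK -[prodw w]reprK -pi_reducedM.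
  set b := repr e; set c := repr (prodw w).
  move=> /esym/pi_reduced_eq[v vu]; rewrite -mulgA => /u_atom[/pi_reduced_eq1|].
    by rewrite reprK => e1; case: (letter_neq1 conE eE).
  by move=> /monoid_unitMl/pi_reduced_eq1.
split=> [/pi_reduced_eq1|a b u_ab]; first exact: letter_neq1 uE.
have [//||] := atomE uE (y := \pi_(reduced H) a) (z := \pi_(reduced H) b).
- by rewrite u_ab pi_reducedM.
- by move=> /pi_reduced_eq1; left.
- by move=> /pi_reduced_eq1; right.
Qed.

(** A word over E lifts to atoms of H through representatives; its product agrees
    with a up to a unit, which is absorbed by the first atom. *)
Lemma set_of_lengthsE (a : H) : set_of_lengths a =
  [set k | exists2 w, factorization E (\pi_(reduced H) a) w & size w = k].
Proof.
apply/seteqP; split=> k /=.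
  move=> [[/pi_reduced_eq1 a1 ->]|[_ [s [<- s_atoms ->]]]].
    by exists [::] => //; rewrite a1; apply: factorization_nil.
  exists (map \pi_(reduced H) s); last by rewrite size_map.
  split; last by rewrite pi_reduced_prod.
  by move=> _ /mapP[u /s_atoms/is_atomP uE ->].
move=> [w wP <-]; have [aunit|aN] := pselect (monoid_unit a).
  left; split=> //; move: wP; rewrite (proj2 (pi_reduced_eq1 a) aunit).
  by move=> /conE->.
right; split=> //; case: w wP => [|e w] [wE wa].
  by case: aN; apply/pi_reduced_eq1; rewrite -wa big_nil.
have /pi_reduced_eq[u uu a_eq] :
    \pi_(reduced H) a = \pi_(reduced H) (repr e * prodw (map repr w)).
  rewrite -wa big_cons pi_reducedM pi_reduced_prod reprK -map_comp.
  by rewrite map_id_in// => y _ /=; rewrite reprK.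
exists (repr e * u :: map repr w); split.
- by rewrite /= size_map.
- move=> v; rewrite inE => /orP[/eqP->|/mapP[y yw ->]]; apply/is_atomP.
    have -> : \pi_(reduced H) (repr e * u) = e.
      by rewrite pi_reducedM (proj2 (pi_reduced_eq1 u) uu) mulg1 reprK.
    by apply: wE; rewrite mem_head.
  by rewrite reprK; apply: wE; rewrite inE yw orbT.
- by rewrite big_cons a_eq -!mulgA [u * _]ccmulC.
Qed.

End Bridge.

(** * Elasticities as real numbers *)
Section LengthRatio.
Variable R : realType.
Local Open Scope ring_scope.

(** The value at max = 0 is the convention that the set of lengths {0} of a unit
    has elasticity 1. *)
Definition length_ratio (max min : nat) : R :=
  if max == 0%N then 1 else max%:R / min%:R.

Lemma length_ratio_ge1 k l : (l <= k)%N -> (l == 0%N) = (k == 0%N) ->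
  1 <= length_ratio k l.
Proof.
rewrite /length_ratio => lk <-; case: eqVneq => // l0.
by rewrite ler_pdivlMr ?ltr0n ?lt0n// mul1r ler_nat.
Qed.

Lemma length_ratio_le k l k' l' : (l' <= k')%N -> (l == 0%N) = (k == 0%N) ->
  (0 < l')%N -> (k * l' <= k' * l)%N -> length_ratio k l <= length_ratio k' l'.
Proof.
move=> l'k' lk l'0 le_kl; have k'0 : (0 < k')%N by apply: leq_trans l'k'.
rewrite /length_ratio -lk (gtn_eqF k'0); case: eqVneq => l0.
  by rewrite ler_pdivlMr ?ltr0n// mul1r ler_nat.
by rewrite ler_pdivrMr ?ltr0n ?lt0n// mulrAC ler_pdivlMr ?ltr0n// -!natrM ler_nat.
Qed.

Lemma elasticityE (L : set nat) k l : L k -> L l ->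
  (forall j, L j -> l <= j <= k)%N -> elasticity R L = length_ratio k l.
Proof.
move=> Lk Ll Lb; rewrite /elasticity /length_ratio.
case: eqVneq => [k0|k0].
  rewrite asboolT//; apply/seteqP; split=> [j /Lb/andP[_]|j ->].
    by rewrite k0 leqn0 => /eqP.
  by rewrite -k0.
rewrite asboolF; last by move=> L0; move: Lk; rewrite L0 /= => /eqP; rewrite (negPf k0).
congr (_ / _); apply/eqP; rewrite eq_le; apply/andP; split.
- apply: ge_sup; first by exists k%:R, k.
  by move=> _ [j /Lb/andP[_ jk] <-]; rewrite ler_nat.
- apply: ub_le_sup; last by exists k.
  by exists k%:R => _ [j /Lb/andP[_ jk] <-]; rewrite ler_nat.
- apply: ge_inf; last by exists l.
  by exists l%:R => _ [j /Lb/andP[lj _] <-]; rewrite ler_nat.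
- apply: lb_le_inf; first by exists l%:R, l.
  by move=> _ [j /Lb/andP[lj _] <-]; rewrite ler_nat.
Qed.

End LengthRatio.

Section Elasticities.
Variables (R : realType) (M : cancelComMonoidType) (E : seq M).
Hypothesis genE : forall x, exists w, factorization E x w.
Hypothesis conE : forall w, factorization E 1%g w -> w = [::].
Local Open Scope ring_scope.
Local Notation maxlen := (maxlen E).
Local Notation minlen := (minlen E).

Definition elast (x : M) : R := length_ratio R (maxlen x) (minlen x).

Lemma maxlen_gt0 x : x <> 1%g -> (0 < maxlen x)%N.
Proof.
by move=> xN1; apply: leq_trans (minlen_gt0 genE xN1) (minlen_le_maxlen genE conE x).
Qed.

Lemma minlen_eq0 x : (minlen x == 0%N) = (maxlen x == 0%N).
Proof.
have [->|/eqP xN1] := eqVneq x 1%g; first by rewrite minlen1 ?maxlen1.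
by rewrite (gtn_eqF (minlen_gt0 genE xN1)) (gtn_eqF (maxlen_gt0 xN1)).
Qed.

Lemma elast1 : elast 1%g = 1.
Proof. by rewrite /elast /length_ratio maxlen1. Qed.

Lemma elastE x : x <> 1%g -> elast x = (maxlen x)%:R / (minlen x)%:R.
Proof. by move=> xN1; rewrite /elast /length_ratio (gtn_eqF (maxlen_gt0 xN1)). Qed.

Lemma elast_ge1 x : 1 <= elast x.
Proof. by apply: length_ratio_ge1; rewrite ?minlen_le_maxlen// minlen_eq0. Qed.

Lemma le_elast x y : y <> 1%g ->
  (maxlen x * minlen y <= maxlen y * minlen x)%N -> elast x <= elast y.
Proof.
by move=> yN1 xy; apply: length_ratio_le; rewrite ?minlen_le_maxlen ?minlen_eq0 ?minlen_gt0.
Qed.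

(** By [power_defect] the elasticity of x^n differs from its upper bound by at most
    k / min (x^n), and min (x^n) grows at least linearly because max (x^n) >= n
    and the elasticities of the powers are bounded. *)
Lemma elast_powers_cvg x N : x <> 1%g -> (0 < N)%N ->
  (forall n, maxlen (x ^+ n)%g * minlen (x ^+ N)%g <=
             maxlen (x ^+ N)%g * minlen (x ^+ n)%g)%N ->
  (fun n => elast (x ^+ n)%g) @ \oo --> elast (x ^+ N)%g.
Proof.
move=> xN1 N0 maxN; have xNN1 := expg_neq1 genE conE xN1 N0.
set P := maxlen (x ^+ N)%g in maxN; set Q := minlen (x ^+ N)%g in maxN.
have Q0 : (0 < Q)%N by apply: minlen_gt0.
have [k defect] := power_defect genE conE x N0; rewrite -/P -/Q in defect.
have bound n : elast (x ^+ N)%g - (P * k)%:R * harmonic n <= elast (x ^+ n.+1)%g.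
  have xnN1 : (x ^+ n.+1)%g <> 1%g by apply: expg_neq1.
  have min0 : (0 < minlen (x ^+ n.+1)%g)%N by apply: minlen_gt0.
  have n_le : (n.+1 <= P * minlen (x ^+ n.+1)%g)%N.
    apply: leq_trans _ (maxN n.+1).
    rewrite (leq_trans _ (leq_mul (maxlenX genE conE x n.+1) Q0))//.
    by rewrite muln1 leq_pmulr// maxlen_gt0.
  rewrite !elastE// -/P -/Q lerBlDr /harmonic.
  set m := minlen (x ^+ n.+1)%g in min0 n_le *; set l := maxlen (x ^+ n.+1)%g.
  apply: (@le_trans _ _ ((l + k)%:R / m%:R)).
    rewrite ler_pdivrMr ?ltr0n// mulrAC ler_pdivlMr ?ltr0n// -!natrM ler_nat.
    rewrite (leq_trans (defect n.+1))// -/m -/l [leqRHS]mulnC mulnDr leq_add2l.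
    by rewrite leq_pmull.
  rewrite natrD mulrDl lerD2l ler_pdivrMr ?ltr0n// mulrAC ler_pdivlMr ?ltr0n//.
  by rewrite -!natrM ler_nat mulnAC mulnC leq_mul2r n_le orbT.
rewrite -cvg_shiftS.
apply: (@squeeze_cvgr _ _ _ _ (fun n => elast (x ^+ N)%g - (P * k)%:R * harmonic n)
  (fun=> elast (x ^+ N)%g)).
- by apply: nearW => n; rewrite bound/= le_elast.
- rewrite -[X in _ --> X]subr0 -[X in _ - X](mulr0 (P * k)%:R).
  by apply: cvgB; [exact: cvg_cst|apply: cvgM; [exact: cvg_cst|exact: cvg_harmonic]].
- exact: cvg_cst.
Qed.

(** At elasticity less than y the defect k bounds min x by k / (p / q - y), and
    the finite elasticity of the monoid, attained at b, then bounds max x. *)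
Lemma finite_elast_below p q k (y : R) : (0 < q)%N ->
  (exists2 b, b <> 1%g & forall x, (maxlen x * minlen b <= maxlen b * minlen x)%N) ->
  (forall x, (p * minlen x <= q * maxlen x + k)%N) -> y < p%:R / q%:R ->
  finite_set (range elast `&` [set z | z < y]).
Proof.
move=> q0 [b bN1 maxb] low y_lt.
pose d := p%:R / q%:R - y; have d0 : 0 < d by rewrite subr_gt0.
have [B Bk] : exists B : nat, k%:R / d <= B%:R.
  exists (Num.bound (k%:R / d)); apply/ltW/archi_boundP; rewrite divr_ge0// ltW//.
have := finite_setX (finite_II (maxlen b * B).+1) (finite_II B.+1).
move=> /(finite_image (fun ij : nat * nat => length_ratio R ij.1 ij.2)).
apply: sub_finite_set => _ [[x _ <-] /= x_lt].
have minB : (minlen x <= B)%N.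
  have [->|/eqP xN1] := eqVneq x 1%g; first by rewrite minlen1.
  have m0 : 0 < (minlen x)%:R :> R by rewrite ltr0n minlen_gt0.
  rewrite -(ler_nat R); apply: le_trans Bk; rewrite ler_pdivlMr//.
  move: x_lt; rewrite elastE// ltr_pdivrMr// => x_lt.
  have := low x; rewrite -(ler_nat R) natrD !natrM => low_x.
  rewrite /d mulrBr lerBlDl.
  have: p%:R * (minlen x)%:R / q%:R <= (maxlen x)%:R + k%:R :> R.
    rewrite ler_pdivrMr ?ltr0n// (le_trans low_x)// mulrDl mulrC lerD2l.
    by rewrite ler_peMr// ler1n.
  rewrite mulrAC mulrC => /le_trans; apply; by rewrite lerD2r mulrC ltW.
exists (maxlen x, minlen x) => //; split; rewrite /= ltnS//.
apply: (@leq_trans (maxlen x * minlen b)); first by rewrite leq_pmulr// minlen_gt0.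
by rewrite (leq_trans (maxb x))// leq_mul2l minB orbT.
Qed.

End Elasticities.

(** * Elasticities of a monoid with finitely generated reduced monoid *)
Section ReducedElasticities.
Variables (R : realType) (H : cancelComMonoidType) (E : seq (reduced H)).
Hypothesis genE : forall x, exists w, factorization E x w.
Hypothesis conE : forall w, factorization E 1%g w -> w = [::].
Hypothesis atomE : {in E, forall x y z, (x = y * z -> y = 1 \/ z = 1)%g}.
Local Open Scope ring_scope.
Local Open Scope quotient_scope.
Local Notation pi := (\pi_(reduced H)).

Lemma elasticity_set_of_lengths (a : H) :
  elasticity R (set_of_lengths a) = elast R E (pi a).
Proof.
have [[v vP v_eq] maxP] := maxlenP genE conE (pi a).
have [[w wP w_eq] minP] := minlenP genE (pi a).
apply: elasticityE; rewrite (set_of_lengthsE genE conE atomE).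
- by exists v.
- by exists w.
- by move=> _ [u uP <-]; rewrite maxP// minP.
Qed.

Lemma elasticities_range : elasticities R H = range (elast R E).
Proof.
apply/seteqP; split=> [_ [_ [a _ <-] <-]|_ [x _ <-]].
  by exists (pi a) => //; rewrite elasticity_set_of_lengths.
exists (set_of_lengths (repr x)); first by exists (repr x).
by rewrite elasticity_set_of_lengths reprK.
Qed.

Lemma pi_neq1 (a : H) : ~ monoid_unit a -> pi a <> 1%g.
Proof. by move=> aN /pi_reduced_eq1. Qed.

Lemma asymptotic_elasticityP (a : H) N : pi a <> 1%g -> (0 < N)%N ->
  (forall n, maxlen E (pi a ^+ n)%g * minlen E (pi a ^+ N)%g <=
             maxlen E (pi a ^+ N)%g * minlen E (pi a ^+ n)%g)%N ->
  asymptotic_elasticity R a = elast R E (pi a ^+ N)%g.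
Proof.
move=> aN1 N0 maxN; apply: cvg_lim => //.
under eq_fun do rewrite elasticity_set_of_lengths pi_reducedX.
exact: elast_powers_cvg.
Qed.

Lemma asymptotic_elasticity_ge (a : H) : pi a <> 1%g ->
  forall n, elast R E (pi a ^+ n)%g <= asymptotic_elasticity R a.
Proof.
move=> aN1 n; have [N N0 maxN] := power_max_elasticity genE conE aN1.
rewrite (asymptotic_elasticityP aN1 N0 maxN).
by apply: le_elast => //; apply: expg_neq1.
Qed.

End ReducedElasticities.

Local Open Scope ring_scope.

Theorem theorem1p2 (R : realType) (H : cancelComMonoidType)
    (Hfg : finitely_generated (reduced H)) :
  let r : \bar R := ereal_inf (EFin @` asymptotic_elasticities R H) in
  [/\ [set (ratr q : R) | q in
         [set q : rat | (r <= (ratr q)%:E <= monoid_elasticity R H)%E]]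
        `<=` elasticities R H,
      forall x : R,
        limit_point
          (elasticities R H `&` [set y | 1 <= y /\ (y%:E < r)%E]) x ->
        x%:E = r
    & (exists a : H, ~ monoid_unit a) -> (fully_elastic R H <-> r = 1%:E)].
Proof.
move=> r.
have [E [genE conE atomE]] := atom_basis (@reduced_conical H) Hfg.
have rangeE := elasticities_range R genE conE atomE.
(* If all elements are units, then r = +oo and 1 is the only elasticity. *)
have [[a0 a0N]|H_group] := pselect (exists a : H, ~ monoid_unit a); last first.
  have r_oo : r = +oo%E.
    rewrite /r (_ : asymptotic_elasticities R H = set0) ?image_set0 ?ereal_inf0//.
    by apply/seteqP; split=> // y [a aN _]; case: H_group; exists a.
  split=> [_ [q /andP[+ _] <-]|x|//]; first by rewrite r_oo leye_eq.
  move=> /limit_point_infinite_setP x_lim; exfalso; apply: (x_lim setT filterT).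
  apply: sub_finite_set (finite_set1 1) => y [_ [+ _]]; rewrite rangeE => -[x' _ <-].
  have -> : x' = 1%g; last by rewrite elast1.
  rewrite -[x']reprK; apply: (proj2 (pi_reduced_eq1 _)); apply: contrapT => x'N.
  by apply: H_group; exists (repr x').
have a0N1 := pi_neq1 a0N.
have exN1 : exists x : reduced H, x <> 1%g by exists (\pi_(reduced H) a0)%qT.
have [e eE [N N0 [maxN minE]]] := least_power_elasticity genE conE exN1.
have eN1 : e <> 1%g := letter_neq1 conE eE.
set P := maxlen E (e ^+ N)%g in maxN minE; set Q := minlen E (e ^+ N)%g in maxN minE.
have eNN1 : (e ^+ N)%g <> 1%g by apply: expg_neq1.
have Q0 : (0 < Q)%N by apply: minlen_gt0.
have elast_eN : elast R E (e ^+ N)%g = P%:R / Q%:R by rewrite elastE.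
have PQ1 : 1 <= P%:R / Q%:R :> R by rewrite -elast_eN elast_ge1.
have rE : r = (P%:R / Q%:R)%:E.
  apply/eqP; rewrite eq_le; apply/andP; split.
    apply: ereal_inf_lbound; exists (P%:R / Q%:R) => //; exists (repr e).
      by move=> /pi_reduced_eq1; rewrite reprK.
    by rewrite (asymptotic_elasticityP R genE conE atomE _ N0); rewrite reprK.
  apply: le_ereal_inf_tmp => _ [_ [a /pi_neq1 aN1 <-] <-]; rewrite lee_fin.
  have [K K0 highK] := high_power genE conE minE.
  apply: le_trans (asymptotic_elasticity_ge R genE conE atomE aN1 K).
  rewrite -elast_eN; apply: le_elast => //; first exact: expg_neq1.
  by rewrite -/P -/Q [leqRHS]mulnC.
have [b bN1 maxb] : exists2 b, b <> 1%g & forall x,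
    (maxlen E x * minlen E b <= maxlen E b * minlen E x)%N.
  have [|z0 _ [z0N1 maxz0]] := @max_elasticity_attained _ E genE conE E.
    by have [x0 x0N1] := exN1; have [w [wE wP]] := genE x0; exists w; rewrite ?wP.
  exists (prodw z0) => // x; have [w [wE <-]] := genE x; exact: maxz0.
have topE : monoid_elasticity R H = (elast R E b)%:E.
  apply/eqP; rewrite eq_le /monoid_elasticity rangeE; apply/andP; split.
    by apply: ge_ereal_sup => _ [_ [x _ <-] <-]; rewrite lee_fin le_elast.
  by apply: ereal_sup_ubound; exists (elast R E b) => //; exists b.
have r_le_top : P%:R / Q%:R <= elast R E b by rewrite -elast_eN le_elast.
have interval_attained : [set (ratr q : R) | q in
    [set q : rat | (r <= (ratr q)%:E <= monoid_elasticity R H)%E]] `<=` elasticities R H.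
  move=> _ [q /= + <-]; rewrite rE topE !lee_fin => /andP[rq qtop].
  have q0 : 0 < q by rewrite -(ltr0q R) (lt_le_trans _ rq)// (lt_le_trans _ PQ1).
  have [n [d [d0 q_nd]]] : exists n d, (0 < d)%N /\ ratr q = n%:R / d%:R :> R.
    exists `|numq q|%N, `|denq q|%N; rewrite absz_gt0 denq_neq0; split=> //.
    by rewrite /ratr !natr_absz gtr0_norm ?numq_gt0// gtr0_norm ?denq_gt0.
  rewrite q_nd in rq qtop *.
  have [||c cN1 c_eq] := @balanced_element _ E genE conE e n d eE.
  - move=> k; rewrite -(leq_pmul2r Q0) -mulnA (leq_trans (leq_mul (leqnn d) (maxN k)))//.
    move: rq; rewrite ler_pdivlMr ?ltr0n// mulrAC ler_pdivrMr ?ltr0n// -!natrM ler_nat.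
    by move=> PdnQ; rewrite mulnA [leqRHS]mulnAC leq_mul2r [(d * P)%N]mulnC PdnQ orbT.
  - exists b => //; move: qtop; rewrite elastE//.
    have mb0 := minlen_gt0 genE bN1.
    rewrite ler_pdivlMr ?ltr0n// mulrAC ler_pdivrMr ?ltr0n// -!natrM ler_nat.
    by rewrite [leqRHS]mulnC.
  rewrite rangeE; exists c => //; rewrite elastE//.
  have mc0 := minlen_gt0 genE cN1.
  apply/eqP; rewrite eqr_div ?pnatr_eq0 -?lt0n//.
  by rewrite -!natrM eqr_nat c_eq mulnC.
have limit_points : forall x : R, limit_point
    (elasticities R H `&` [set y | 1 <= y /\ (y%:E < r)%E]) x -> x%:E = r.
  move=> x /limit_point_infinite_setP x_lim; rewrite rE; congr (_%:E).
  apply/eqP; case: ltgtP => // [x_lt|x_gt]; exfalso.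
  - have [k low] := high_up_to_constant genE conE minE.
    have mid_lt : (x + P%:R / Q%:R) / 2 < P%:R / Q%:R.
      by rewrite midf_lt.
    have := finite_elast_below genE conE Q0 (ex_intro2 _ _ b bN1 maxb) low mid_lt.
    have U : nbhs x [set y | y < (x + P%:R / Q%:R) / 2].
      by apply: open_nbhs_nbhs; split; [exact: open_lt|rewrite /= midf_lt].
    move=> fin; apply: (x_lim _ U); apply: sub_finite_set fin => y [ylt [yE _]].
    by split=> //; rewrite -rangeE.
  - have U : nbhs x [set y | P%:R / Q%:R < y].
      by apply: open_nbhs_nbhs; split; [exact: open_gt|].
    have [y [/= y_gt [_ [_]]]] := infinite_setN0 (x_lim _ U).
    by rewrite rE lte_fin => /(lt_trans y_gt); rewrite ltxx.
split=> // _; split=> [elastic|r1 q q1 q_lt]; last first.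
  suff /interval_attained[L] : [set (ratr q : R) | q in
      [set q : rat | (r <= (ratr q)%:E <= monoid_elasticity R H)%E]] (ratr q).
    by move=> ? ?; exists L.
  by exists q => //=; rewrite (ltW q_lt) andbT r1 lee_fin -[1]/(1%:R) -(ratr_nat R) ler_rat ltW.
rewrite rE; congr (_%:E); apply/eqP; rewrite eq_le PQ1 andbT leNgt; apply/negP => r_gt1.
have mid_gt1 : 1 < (1 + P%:R / Q%:R) / 2 :> R by rewrite midf_lt.
have mid_lt : (1 + P%:R / Q%:R) / 2 < P%:R / Q%:R :> R by rewrite midf_lt.
suff /limit_points : limit_point
    (elasticities R H `&` [set y | 1 <= y /\ (y%:E < r)%E]) ((1 + P%:R / Q%:R) / 2).
  by rewrite rE => -[] /eqP; rewrite lt_eqF.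
move=> U /nbhs_ballP[eps /= eps0 epsU].
have [|q] := rat_in_itvoo (x := (1 + P%:R / Q%:R) / 2)
  (y := Num.min ((1 + P%:R / Q%:R) / 2 + eps) (P%:R / Q%:R)).
  by rewrite lt_min ltrDl eps0.
rewrite in_itv /= lt_min => /and3P[q_gt q_eps q_lt].
exists (ratr q); split.
- by rewrite gt_eqF.
- split; last by split; [rewrite ltW// (lt_trans mid_gt1)|rewrite rE lte_fin].
  have [||L [a _ <-] <-] := elastic q.
  + by rewrite -(ltr_rat R) rmorph1 (lt_trans mid_gt1).
  + by rewrite topE lte_fin (lt_le_trans q_lt).
  by exists (set_of_lengths a) => //; exists a.
- by apply: epsU; rewrite /ball /= ltr_distlC (lt_trans _ q_gt) ?ltrBlDr ?ltrDl.
Qed.
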